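(* Let $d\ge1$, let $k(x,y)=e^{-\sigma\|x-y\|_2^2}$ be the Gaussian kernel on $[0,1]^d$ with $\sigma>0$, and let $P$ be a probability measure on $[0,1]^d$ with density $p$ satisfying $0<\inf p\le\sup p<\infty$. Let $\mu_1\ge\mu_2\ge\dots$ be the eigenvalues and $\varphi_1,\varphi_2,\dots$ the corresponding eigenfunctions in the Mercer decomposition of $k$. Then for every $\ell\in\mathbb{N}$, $$\sup_{x\in[0,1]^d}|\varphi_\ell(x)|\le\sqrt{18c_p}\,\big(3c_\sigma s(\mu_\ell)+2\big)^d+\sqrt2,$$ where $s(\mu_\ell)=\max\big\{-\tfrac12\ln\big(\tfrac{\mu_\ell}{9}\big),\ e,\ d\cdot c\big\}$.
   Context: The $\varphi_\ell$ are the continuous, $L^2([0,1]^d,P)$-orthonormal eigenfunctions, with eigenvalues $\mu_\ell$ in non-increasing order (with multiplicity), of the operator $(L_kf)(y)=\int_{[0,1]^d}k(z,y)f(z)p(z)\,dz$ on $L^2([0,1]^d,P)$, so that $k(x,y)=\sum_{\ell\ge1}\mu_\ell\varphi_\ell(x)\varphi_\ell(y)$. Constants: $c_\sigma=\max\{1,2e\sigma d\}$, $c_p=\sup_{z\in[0,1]^d}p(z)^{-1}$ and $c=\max\{c_0,c_1,c_2,1\}$ with $$c_0=\frac{\ln 3+(d-1)\ln2+\frac12\ln c_p+d\ln(3c_\sigma d)}{2d\ln3},\quad c_1=\frac{(2d-1)\ln2+d\ln(3c_\sigma)+\frac12\ln c_p}{d}+1,\quad c_2=\frac{(2d-1)\ln2+\frac12\ln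 c_p}{d}.$$ *)

(* Defs.v *)
From HB Require Import structures.
From mathcomp Require Import all_boot all_order all_algebra.
From mathcomp Require Import all_classical all_reals all_analysis.
Set Implicit Arguments.
Unset Strict Implicit.
Unset Printing Implicit Defensive.
Import Order.TTheory GRing.Theory Num.Theory.
Import numFieldNormedType.Exports.
Local Open Scope classical_set_scope.
Local Open Scope ring_scope.

(* R^n is 'rV[R]_n, with the sigma-algebra generated by the coordinates (that
   is, the Borel sigma-algebra). *)
Definition rV_display : measure_display.
Proof. exact: default_measure_display. Qed.

Definition rV_coor (R : realType) n (i : 'I_n) (v : 'rV[R]_n) :
  measurableTypeR R := v ord0 i.

Section rV_measurable.
Variables (R : realType) (n : nat).

Let rV_set0 : g_sigma_preimage (@rV_coor R n) set0.
Proof. exact: sigma_algebra0. Qed.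

Let rV_setC A :
  g_sigma_preimage (@rV_coor R n) A -> g_sigma_preimage (@rV_coor R n) (~` A).
Proof. exact: sigma_algebraC. Qed.

Let rV_bigcup (F : (set 'rV[R]_n)^nat) :
  (forall i, g_sigma_preimage (@rV_coor R n) (F i)) ->
  g_sigma_preimage (@rV_coor R n) (\bigcup_i (F i)).
Proof. exact: sigma_algebra_bigcup. Qed.

HB.instance Definition _ := @isMeasurable.Build rV_display
  'rV[R]_n (g_sigma_preimage (@rV_coor R n)) rV_set0 rV_setC rV_bigcup.

End rV_measurable.

Lemma measurable_rV_coor (R : realType) n (i : 'I_n) :
  measurable_fun [set: 'rV[R]_n] (rV_coor i).
Proof.
move=> _ Y mY; rewrite setTI; apply: sub_sigma_algebra => /=.
rewrite -bigcup_seq/=; exists i => /=; first by rewrite mem_index_enum.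
by exists Y => //; rewrite setTI.
Qed.

Lemma measurable_fun_rVP (R : realType) d (T : measurableType d) n
    (f : T -> 'rV[R]_n) :
  (forall i, measurable_fun [set: T] (rV_coor i \o f)) ->
  measurable_fun [set: T] f.
Proof.
move=> mf; suff prefS : g_sigma_preimage (fun i => @rV_coor R n i \o f)
    `<=` measurable.
  move=> _ A mA; apply: prefS; rewrite g_sigma_preimage_comp.
  by exists A.
apply: smallest_sub; first exact: sigma_algebra_measurable.
rewrite -bigcup_seq/=; apply: bigcup_sub => i _.
by move=> A [B mB <-]; exact: mf.
Qed.

(* The library's own instance is shadowed by the one for subprobabilities. *)
Lemma sigma_finite_prod d1 d2 (T1 : measurableType d1)
    (T2 : measurableType d2) (R : realType)
    (m1 : {sigma_finite_measure set T1 -> \bar R})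
    (m2 : {sigma_finite_measure set T2 -> \bar R}) :
  sigma_finite setT (m1 \x m2)%E.
Proof.
have /sigma_finiteP[F [TF ndF Foo]] := sigma_finiteT m1.
have /sigma_finiteP[G [TG ndG Goo]] := sigma_finiteT m2.
exists (fun n => F n `*` G n).
  rewrite -setXTT TF TG predeqE => -[x y]; split.
    move=> [/= [n _ Fnx] [k _ Gky]]; exists (maxn n k) => //; split.
    - by move: x Fnx; exact/subsetPset/ndF/leq_maxl.
    - by move: y Gky; exact/subsetPset/ndG/leq_maxr.
  by move=> [n _ []/= ? ?]; split; exists n.
move=> k; have [? ?] := Foo k; have [? ?] := Goo k.
split; first exact: measurableX.
by rewrite product_measure1E// lte_mul_pinfty// ge0_fin_numE.
Qed.

Section lebesgue_rV.
Variable R : realType.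

Definition rV_cons n (x : measurableTypeR R * 'rV[R]_n) : 'rV[R]_n.+1 :=
  \row_i oapp (x.2 ord0) x.1 (unlift ord0 i).

Definition rV_uncons n (v : 'rV[R]_n.+1) : measurableTypeR R * 'rV[R]_n :=
  (v ord0 ord0, \row_i v ord0 (lift ord0 i)).

Lemma rV_consK n : cancel (@rV_cons n) (@rV_uncons n).
Proof.
case=> a w; rewrite /rV_uncons /rV_cons mxE unlift_none /=; congr (_, _).
by apply/rowP => i; rewrite !mxE liftK.
Qed.

Lemma measurable_rV_cons n : measurable_fun setT (@rV_cons n).
Proof.
apply: measurable_fun_rVP => i.
case: (unliftP ord0 i) => [j ->|->].
  rewrite (_ : _ \o _ = rV_coor j \o snd).
    by apply: measurableT_comp => //; exact: measurable_rV_coor.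
  by apply/funext => x; rewrite /rV_coor /rV_cons /= mxE liftK.
rewrite (_ : _ \o _ = fst) //.
by apply/funext => x; rewrite /rV_coor /rV_cons /= mxE unlift_none.
Qed.

Lemma measurable_rV_uncons n : measurable_fun setT (@rV_uncons n).
Proof.
apply: measurable_fun_pair; first exact: measurable_rV_coor.
apply: measurable_fun_rVP => i.
rewrite (_ : _ \o _ = rV_coor (lift ord0 i)); first exact: measurable_rV_coor.
by apply/funext => v; rewrite /rV_coor /= mxE.
Qed.

Section step.
Variables (n : nat) (m : {sigma_finite_measure set 'rV[R]_n -> \bar R}).

Definition lebesgue_rV_step : set 'rV[R]_n.+1 -> \bar R :=
  pushforward (@lebesgue_measure R \x m)%E (@rV_cons n).

Let step0 : lebesgue_rV_step set0 = 0%E.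
Proof. by rewrite /lebesgue_rV_step /pushforward preimage_set0 measure0. Qed.

Let step_ge0 A : (0 <= lebesgue_rV_step A)%E.
Proof. by rewrite /lebesgue_rV_step /pushforward measure_ge0. Qed.

Let step_sigma_additive : semi_sigma_additive lebesgue_rV_step.
Proof.
move=> F mF tF mUF; rewrite /lebesgue_rV_step /pushforward preimage_bigcup.
apply: measure_semi_sigma_additive.
- move=> k; rewrite -[X in measurable X]setTI.
  by apply: measurable_rV_cons.
- apply/trivIsetP => /= i j _ _ ij; rewrite -preimage_setI.
  by move/trivIsetP : tF => /(_ _ _ _ _ ij) ->//; rewrite preimage_set0.
- rewrite -preimage_bigcup -[X in measurable X]setTI.
  exact: measurable_rV_cons.
Qed.

HB.instance Definition _ := isMeasure.Build _ _ _
  lebesgue_rV_step step0 step_ge0 step_sigma_additive.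

Let step_sigma_finite : sigma_finite setT lebesgue_rV_step.
Proof.
have [F FT mF] : sigma_finite setT (@lebesgue_measure R \x m)%E.
  exact: sigma_finite_prod.
exists (fun k => @rV_uncons n @^-1` F k).
  by rewrite -preimage_bigcup -FT preimage_setT.
move=> k; split.
  rewrite -[X in measurable X]setTI; apply: measurable_rV_uncons => //.
  exact: (mF k).1.
rewrite /lebesgue_rV_step /pushforward -comp_preimage.
rewrite (_ : _ @^-1` _ = F k); first exact: (mF k).2.
by apply/seteqP; split => x /=; rewrite rV_consK.
Qed.

HB.instance Definition _ := Measure_isSigmaFinite.Build _ _ _
  lebesgue_rV_step step_sigma_finite.

End step.

(* Lebesgue measure on R^n, as the iterated product of the Lebesgue measure on
   R; R^0 is a point, of mass 1. *)
Fixpoint lebesgue_rV n : {sigma_finite_measure set 'rV[R]_n -> \bar R} :=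
  match n with
  | 0 => \d_(0 : 'rV[R]_0)
  | n'.+1 => lebesgue_rV_step (lebesgue_rV n')
  end.

End lebesgue_rV.
Arguments lebesgue_rV {R} n.

Section gaussian_mercer.
Variables (R : realType) (d : nat).
Implicit Types (sigma : R) (p f : 'rV[R]_d -> R).

Definition cube : set 'rV[R]_d := [set x | forall i, 0 <= x ord0 i <= 1].

(* P is a measure on R^d: this says that it is carried by the cube, and has
   density p there. The values of p off the cube are irrelevant. *)
Definition has_density (P : set 'rV[R]_d -> \bar R) p :=
  measurable_fun cube p /\
  forall A, measurable A ->
    P A = (\int[lebesgue_rV d]_(x in A `&` cube) (p x)%:E)%E.

Definition gauss_kernel sigma (x y : 'rV[R]_d) : R :=
  expR (- sigma * \sum_(i < d) (x ord0 i - y ord0 i) ^+ 2).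

Definition integral_op (k : 'rV[R]_d -> 'rV[R]_d -> R) p f (y : 'rV[R]_d) : R :=
  \int[lebesgue_rV d]_(z in cube) (k z y * f z * p z).

(* Functions on the cube are functions on R^d, of which only the restriction
   to the cube matters. Indices start at 0: mu l and phi l are the
   (l+1)-st eigenvalue and eigenfunction. The last field forces the list of
   eigenpairs to be complete, with multiplicities. *)
Record mercer_decomposition (k : 'rV[R]_d -> 'rV[R]_d -> R)
    (P : probability 'rV[R]_d R) p
    (mu : nat -> R) (phi : nat -> 'rV[R]_d -> R) : Prop := {
  mercer_nonincreasing : forall l m, (l <= m)%N -> mu m <= mu l ;
  mercer_continuous : forall l, {within cube, continuous (phi l)} ;
  mercer_L2 : forall l, (phi l \_ cube) \in Lfun P 2%:E ;
  mercer_orthonormal : forall l m,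
    \int[P]_(x in cube) (phi l x * phi m x) = (l == m)%:R ;
  mercer_eigen : forall l,
    {ae P, forall y, cube y -> integral_op k p (phi l) y = mu l * phi l y} ;
  mercer_expansion : forall x y, cube x -> cube y ->
    series (fun l => mu l * phi l x * phi l y) @ \oo --> k x y
}.

Definition c_sigma sigma : R := Num.max 1 (2 * expR 1 * sigma * d%:R).

Definition c_p p : R := sup [set (p z)^-1 | z in cube].

Definition c_0 sigma p : R :=
  (ln 3 + (d%:R - 1) * ln 2 + 2^-1 * ln (c_p p)
     + d%:R * ln (3 * c_sigma sigma * d%:R)) / (2 * d%:R * ln 3).

Definition c_1 sigma p : R :=
  ((2 * d%:R - 1) * ln 2 + d%:R * ln (3 * c_sigma sigma)
     + 2^-1 * ln (c_p p)) / d%:R + 1.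

Definition c_2 p : R :=
  ((2 * d%:R - 1) * ln 2 + 2^-1 * ln (c_p p)) / d%:R.

Definition c_max sigma p : R :=
  Num.max (c_0 sigma p) (Num.max (c_1 sigma p) (Num.max (c_2 p) 1)).

Definition s_trunc sigma p (t : R) : R :=
  Num.max (- 2^-1 * ln (t / 9)) (Num.max (expR 1) (d%:R * c_max sigma p)).

End gaussian_mercer.
Arguments cube {R d}.
Arguments c_sigma {R} d sigma.

(* Main.v *)
(* Testing the Mercer expansion against a combination of point masses shows
   that every eigenvalue is positive, because the Gaussian is strictly positive
   definite. Replacing the exponential by its Taylor polynomial of degree [N] in
   [phi = mu^-1 \int k(z, .) phi(z) p(z) dz] gives a function [q] which is a
   polynomial of degree at most [2 N] in each variable, at uniform distance at
   most [mu^-1 (sigma d)^(N+1) / (N+1)!] from [phi]; this is at most [1/9] as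
   soon as [N + 1 >= (3/2) c_sigma s(mu)]. Since [phi] has norm [1], [q] has
   bounded norm in [L^2(P)], hence in [L^2(dx)] at the cost of [c_p].
   A polynomial of degree [n] satisfies [q(x)^2 <= (n+1)^2 \int_0^1 q^2] on
   [[0, 1]], and iterating this over the [d] coordinates bounds [q]. *)
Require Import Defs.
From HB Require Import structures.
From mathcomp Require Import all_boot all_order all_algebra.
From mathcomp Require Import qpoly ring lra.
From mathcomp Require Import all_classical all_reals all_analysis.
From mathcomp Require Import measurable_realfun.
Import Order.TTheory GRing.Theory Num.Theory.
Import numFieldNormedType.Exports.
Local Open Scope classical_set_scope.
Local Open Scope ring_scope.

Set Implicit Arguments.
Unset Strict Implicit.
Unset Printing Implicit Defensive.

(** * Polynomials in one variable *)

Section poly_nikolskii.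
Variable R : realType.
Implicit Types (p q Q K : {poly R}) (n : nat).

(** Serves twice: for the positivity of the integral of a square and, applied to both signs, for the
    constancy of a polynomial with zero derivative. *)
Lemma le_horner_deriv_ge0 Q a b : a <= b ->
  (forall x, 0 <= Q^`().[x]) -> Q.[a] <= Q.[b].
Proof.
move=> ab Q'ge0; apply: (@ger0_derive1_ndecr _ (horner Q) a b) => //.
- by move=> x _; rewrite -derivE.
- by apply: continuous_subspaceT => x; exact: continuous_horner.
Qed.

(** The antiderivative vanishing at 0: the coefficient at [i = 0] is 0 because [0^-1 = 0]. Integrals
    over [0, 1] become values at 1, which keeps the argument algebraic. *)
Definition prim_poly p : {poly R} := \poly_(i < (size p).+1) (p`_i.-1 / i%:R).

Lemma coef_prim_poly p i : (prim_poly p)`_i = p`_i.-1 / i%:R.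
Proof.
rewrite coef_poly ltnS; case: leqP => // pi.
case: i pi => [|i] pi; first by rewrite invr0 mulr0.
by rewrite nth_default ?mul0r.
Qed.

Lemma deriv_prim_poly p : (prim_poly p)^`() = p.
Proof.
apply/polyP => i; rewrite coef_deriv coef_prim_poly -[LHS]mulr_natr /=.
by rewrite divfK// pnatr_eq0.
Qed.

Lemma prim_poly0 p : (prim_poly p).[0] = 0.
Proof. by rewrite horner_coef0 coef_prim_poly invr0 mulr0. Qed.

Lemma prim_poly_is_linear : linear prim_poly.
Proof.
move=> a p q; apply/polyP => i.
by rewrite coefD coefZ !coef_prim_poly coefD coefZ mulrDl mulrA.
Qed.

HB.instance Definition _ := GRing.isLinear.Build R {poly R} {poly R} _ prim_poly
  prim_poly_is_linear.

Lemma horner1_prim_poly p :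
  (prim_poly p).[1] = \sum_(i < size p) p`_i / i.+1%:R.
Proof.
rewrite /prim_poly horner_poly big_ord_recl invr0 mulr0 mul0r add0r.
by apply: eq_bigr => i _; rewrite expr1n mulr1.
Qed.

Lemma horner1_prim_poly_widen n p : (size p <= n)%N ->
  (prim_poly p).[1] = \sum_(i < n) p`_i / i.+1%:R.
Proof.
move=> pn; rewrite horner1_prim_poly.
rewrite (big_ord_widen _ (fun i => p`_i / i.+1%:R) pn).
rewrite big_mkcond; apply: eq_bigr => i _; case: ltnP => // /leq_sizeP pi.
by rewrite pi// mul0r.
Qed.

Lemma prim_poly_XnM n i K : (size K <= n)%N ->
  (prim_poly ('X^i * K)).[1] = \sum_(j < n) K`_j / (i + j).+1%:R.
Proof.
move=> Kn; rewrite (@horner1_prim_poly_widen (i + n)); last first.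
  by rewrite (leq_trans (size_polyMleq _ _))// size_polyXn addSn leq_add2l.
rewrite big_split_ord /= big1 ?add0r => [|j _].
  by apply: eq_bigr => j _; rewrite coefXnM ltnNge leq_addr /= addKn.
by rewrite coefXnM ltn_ord mul0r.
Qed.

(* The numbers [K`_j] are the residues of the rational function
   [a (x - 1) ... (x - n) / ((x + 1) ... (x + n + 1))], where [a] is chosen so
   that its value at [0] is [1]; its value at [i] is [\int_0^1 t^i K(t) dt]. *)
Lemma reproducing_poly n : exists K,
  [/\ (size K <= n.+1)%N, K.[0] = n.+1%:R ^+ 2 &
      forall p, (size p <= n.+1)%N -> (prim_poly (p * K)).[1] = p.[0]].
Proof.
pose x (j : nat) : R := - j.+1%:R.
have xI : injective x by move=> i j /oppr_inj /eqP; rewrite eqr_nat => /eqP[].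
pose D : {poly R} := \prod_(j < n.+1) ('X - (x j)%:P).
pose B : {poly R} := \prod_(j < n) ('X - (j.+1%:R)%:P).
pose A := (D.[0] / B.[0]) *: B.
pose l (j : 'I_n.+1) : {poly R} := \prod_(i < n.+1 | i != j) ('X - (x i)%:P).
pose k (j : 'I_n.+1) : R := A.[x j] / (l j).[x j].
have sA : (size A <= n.+1)%N.
  rewrite (leq_trans (size_scale_leq _ _))// /B.
  by rewrite -big_enum /= size_prod_XsubC size_enum_ord.
have DE t : D.[t] = \prod_(j < n.+1) (t + j.+1%:R).
  by rewrite horner_prod; apply: eq_bigr => j _; rewrite !hornerE opprK.
have lE j t : (l j).[t] = \prod_(i < n.+1 | i != j) (t + i.+1%:R).
  by rewrite horner_prod; apply: eq_bigr => i _; rewrite !hornerE opprK.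
have BE t : B.[t] = \prod_(j < n) (t - j.+1%:R).
  by rewrite horner_prod; apply: eq_bigr => j _; rewrite !hornerE.
have D_neq0 i : D.[i%:R] != 0.
  rewrite DE prodf_seq_neq0; apply/allP => j _.
  by rewrite -natrD pnatr_eq0 addnS.
(* Lagrange interpolation of [A] at the poles [x j], divided by [D], is the partial fraction
   expansion with residues [k j]. *)
have partial i : \sum_j k j / (i + j).+1%:R = A.[i%:R] / D.[i%:R].
  rewrite {1}(lagrange_gen (ltn0Sn n) xI sA) horner_sum mulr_suml.
  apply: eq_bigr => j _; rewrite hornerM hornerC (lagrangeE (ltn0Sn n) xI) /=.
  rewrite hornerM hornerC -/(l j) [A.[_] * _]mulrA -/(k j) -mulrA.
  congr (_ * _).
  have -> : D.[i%:R] = (i + j).+1%:R * (l j).[i%:R].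
    by rewrite DE (bigD1 j)//= lE -natrD addnS.
  rewrite invfM mulrCA mulfV ?mulr1//.
  by rewrite lE prodf_seq_neq0; apply/allP => m _;
    rewrite -natrD pnatr_eq0 addnS implybT.
have B0 : B.[0] = (-1) ^+ n * \prod_(j < n) j.+1%:R.
  rewrite BE; under eq_bigr do rewrite add0r.
  by rewrite prodrN card_ord.
have Bm1 : B.[-1] = (-1) ^+ n * D.[0].
  have -> : D.[0] = \prod_(j < n) j.+2%:R.
    rewrite DE big_ord_recl add0r mul1r; apply: eq_bigr => j _.
    by rewrite add0r lift0.
  rewrite BE (eq_bigr (fun j : 'I_n => - j.+2%:R)) => [|j _].
    by rewrite prodrN card_ord.
  by rewrite [in RHS]mulrS opprD.
have F_neq0 : \prod_(j < n) j.+1%:R != 0 :> R.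
  by rewrite prodf_seq_neq0; apply/allP => j _; rewrite pnatr_eq0.
have l0 : (l ord0).[-1] = \prod_(j < n) j.+1%:R.
  rewrite lE big_mkcond big_ord_recl /= mul1r.
  by apply: eq_bigr => j _; rewrite mulrS addKr.
(* Here [D.[0] = (n+1)!], [A.[-1] = D.[0]^2 / n!] and [(l ord0).[-1] = n!], so the quotient is
   [((n+1)! / n!)^2]. *)
have k0 : k ord0 = n.+1%:R ^+ 2.
  rewrite /k /A hornerZ Bm1 B0 l0 DE big_ord_recr /=.
  under eq_bigr do rewrite add0r.
  by rewrite add0r; field; rewrite F_neq0 signr_eq0.
pose K : {poly R} := \poly_(j < n.+1) k (inord j).
have KE (j : 'I_n.+1) : K`_j = k j by rewrite coef_poly ltn_ord inord_val.
have sK : (size K <= n.+1)%N by exact: size_poly.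
exists K; split => // [|p sp].
  by rewrite horner_coef0 (KE ord0).
have pE : p = \sum_(i < n.+1) p`_i *: 'X^i.
  rewrite -poly_def; apply/polyP => i; rewrite coef_poly.
  by case: ltnP => // /(leq_trans sp) /leq_sizeP ->.
rewrite [in LHS]pE mulr_suml linear_sum horner_sum.
transitivity (\sum_(i < n.+1) p`_i * (A.[i%:R] / D.[i%:R])).
  apply: eq_bigr => i _; rewrite -scalerAl linearZ hornerZ (prim_poly_XnM _ sK).
  by rewrite -partial; under eq_bigr do rewrite KE.
have A0 : A.[0] / D.[0] = 1.
  rewrite /A hornerZ divfK ?mulfV//; first exact: (D_neq0 0%N).
  by rewrite B0 mulf_neq0// signr_eq0.
(* [A] vanishes at 1, ..., n, so only the coefficient of index 0 survives. *)
rewrite big_ord_recl big1 => [|i _].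
  by rewrite addr0 A0 mulr1 horner_coef0.
have Bi : B.[(lift ord0 i)%:R] = 0 by rewrite BE (bigD1 i)//= subrr mul0r.
by rewrite /A hornerZ Bi mulr0 mul0r mulr0.
Qed.

(** Cauchy-Schwarz against the kernel [K] of [reproducing_poly]: the integral of [(q - c K)^2] is
    nonnegative, those of [q K] and [K^2] are [q.[0]] and [(n+1)^2], and [c] is the minimizer. *)
Lemma poly_nikolskii0 n q : (size q <= n.+1)%N ->
  q.[0] ^+ 2 <= n.+1%:R ^+ 2 * (prim_poly (q ^+ 2)).[1].
Proof.
move=> sq; have [K [sK K0 KE]] := reproducing_poly n.
pose c := q.[0] / n.+1%:R ^+ 2.
have N0 : n.+1%:R != 0 :> R by rewrite pnatr_eq0.
have : 0 <= (prim_poly ((q - c *: K) ^+ 2)).[1].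
  rewrite -(prim_poly0 ((q - c *: K) ^+ 2)); apply: le_horner_deriv_ge0 => // x.
  by rewrite deriv_prim_poly horner_exp sqr_ge0.
have -> : (q - c *: K) ^+ 2 = q ^+ 2 - (c *+ 2) *: (q * K) + c ^+ 2 *: (K * K).
  by rewrite -!mul_polyC rmorphMn rmorphXn /=; ring.
rewrite linearD linearB !linearZ /= !(hornerE, KE) // K0 => h.
rewrite mulrC -ler_pdivrMr ?exprn_gt0// -subr_ge0.
by apply: le_trans h _; rewrite /c le_eqVlt; apply/orP; left; apply/eqP; field.
Qed.

(* [t] is the mean of [q ^+ 2] between [x] and [y], so this is the bound at an
   end point, transported to that interval. *)
Lemma poly_nikolskii_signed n q Q x y : (size q <= n.+1)%N -> Q^`() = q ^+ 2 ->
  exists2 t, q.[x] ^+ 2 <= n.+1%:R ^+ 2 * t & (y - x) * t = Q.[y] - Q.[x].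
Proof.
move=> sq Q'E; pose v : {poly R} := x%:P + (y - x) *: 'X.
pose r := q \Po v.
have sr : (size r <= n.+1)%N.
  (* The substitution [v] is constant when [y = x], a case outside [size_comp_poly2]. *)
  have [|v0] := leqP (size v) 1.
    move=> /size1_polyC vE; rewrite /r vE comp_polyCr.
    by rewrite (leq_trans (size_polyC_leq1 _)).
  have sv : (size v <= 2)%N.
    rewrite (leq_trans (size_polyD _ _))// geq_max.
    rewrite (leq_trans (size_polyC_leq1 _))//.
    by rewrite (leq_trans (size_scale_leq _ _))// size_polyX.
  have {sv}v2 : size v = 2%N by apply/eqP; rewrite eqn_leq sv.
  by rewrite /r size_comp_poly2.
exists (prim_poly (r ^+ 2)).[1].
  by have := poly_nikolskii0 sr; rewrite {1}/r horner_comp /v !hornerE.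
(* The change of variables: [W] has zero derivative, hence equal values at 0 and 1. *)
pose W := (y - x) *: prim_poly (r ^+ 2) - (Q \Po v).
have W'0 : W^`() = 0.
  rewrite derivB derivZ deriv_prim_poly deriv_comp Q'E.
  rewrite /v derivD derivC add0r derivZ derivX alg_polyC.
  by rewrite rmorphXn /= -/v -/r mulrC mul_polyC subrr.
have W01 : W.[0] = W.[1].
  apply/eqP; rewrite eq_le le_horner_deriv_ge0 => [/=|//|t]; last first.
    by rewrite W'0 horner0.
  rewrite -lerN2 -!hornerN le_horner_deriv_ge0 => [//|//|t].
  by rewrite derivN W'0 oppr0 horner0.
move: W01; rewrite /W !hornerE !horner_comp prim_poly0 /v !hornerE /=.
by rewrite [x + y - x]addrAC subrr add0r => h; lra.
Qed.

(* The bound at an end point is applied on both sides of [x]. *)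
Lemma poly_nikolskii n q Q x : (size q <= n.+1)%N -> Q^`() = q ^+ 2 ->
  0 <= x <= 1 -> q.[x] ^+ 2 <= n.+1%:R ^+ 2 * (Q.[1] - Q.[0]).
Proof.
move=> sq Q'E /andP[x0 x1].
have [t1 h1 e1] := poly_nikolskii_signed x 1 sq Q'E.
have [t0 h0 e0] := poly_nikolskii_signed x 0 sq Q'E.
(* The mean over [0, 1] is a convex combination of the means on the two sides of [x], so the two
   bounds combine without loss. *)
have -> : Q.[1] - Q.[0] = (1 - x) * t1 + x * t0 by rewrite e1; lra.
have := ler_wpM2l x0 h0; have := @ler_wpM2l _ (1 - x) _ _ _ h1.
rewrite subr_ge0 => /(_ x1); set a := _ ^+ 2; set b := _ ^+ 2; lra.
Qed.

Lemma integral_poly_itv01 Q q : Q^`() = q ->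
  (\int[lebesgue_measure]_(t in `[0%R, 1%R]) (q.[t])%:E = (Q.[1] - Q.[0])%:E)%E.
Proof.
move=> <-.
rewrite (@continuous_FTC2 _ (horner Q^`()) (horner Q)) ?ltr01 ?EFinB//.
- by apply: continuous_subspaceT => x; exact: continuous_horner.
- split => [x _|//|//]; first exact: derivable_horner.
  by apply: cvg_at_right_filter; exact: continuous_horner.
  by apply: cvg_at_left_filter; exact: continuous_horner.
- by move=> x _; rewrite -derivE.
Qed.

Lemma le_sqr_integral_poly n q x : (size q <= n.+1)%N -> 0 <= x <= 1 ->
  ((q.[x] ^+ 2)%:E <= (n.+1%:R ^+ 2)%:E *
    \int[lebesgue_measure]_(t in `[0%R, 1%R]) (q.[t] ^+ 2)%:E)%E.
Proof.
move=> sq x01; have Q'E := deriv_prim_poly (q ^+ 2).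
under eq_integral do rewrite -horner_exp.
rewrite (integral_poly_itv01 Q'E) -EFinM lee_fin.
exact: poly_nikolskii.
Qed.

End poly_nikolskii.

(** * Polynomials in several variables *)

Section rV_boxes.
Variable R : realType.
Implicit Types d : nat.

Definition rV_box d (a b : 'rV[R]_d) : set 'rV[R]_d :=
  [set x | forall i, a ord0 i <= x ord0 i <= b ord0 i].

Lemma cubeE d : cube = rV_box 0 (const_mx 1) :> set 'rV[R]_d.
Proof. by apply/seteqP; split => x cx i; have := cx i; rewrite !mxE. Qed.

Lemma measurable_rV_box d (a b : 'rV[R]_d) : measurable (rV_box a b).
Proof.
rewrite (_ : rV_box a b = \bigcap_(i in [set: 'I_d])
    (@rV_coor R d i @^-1` `[a ord0 i, b ord0 i])).
  apply: fin_bigcap_measurable => // i _; rewrite -[X in measurable X]setTI.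
  exact: measurable_rV_coor.
apply/seteqP; split => x.
  by move=> abx i _; rewrite /= in_itv/=; exact: abx.
by move=> abx i; have := abx i I; rewrite /= in_itv/=.
Qed.

Lemma measurable_cube d : measurable (cube : set 'rV[R]_d).
Proof. by rewrite cubeE; exact: measurable_rV_box. Qed.

Lemma rV_unconsK d : cancel (@rV_uncons R d) (@rV_cons R d).
Proof.
move=> v; apply/rowP => i; rewrite !mxE.
by case: unliftP => [j ->|->] //=; rewrite mxE.
Qed.

Lemma rV_cons0 d t (y : 'rV[R]_d) : rV_cons (t, y) ord0 ord0 = t.
Proof. by rewrite mxE unlift_none. Qed.

Lemma rV_consS d t (y : 'rV[R]_d) i :
  rV_cons (t, y) ord0 (lift ord0 i) = y ord0 i.
Proof. by rewrite mxE liftK. Qed.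

Lemma preimage_rV_cons_box d (a b : 'rV[R]_d.+1) :
  @rV_cons R d @^-1` rV_box a b =
  `[a ord0 ord0, b ord0 ord0] `*` rV_box (rV_uncons a).2 (rV_uncons b).2.
Proof.
apply/seteqP; split => -[t y] /=.
  move=> abx; split; first by have := abx ord0; rewrite rV_cons0 in_itv.
  by move=> i; have := abx (lift ord0 i); rewrite rV_consS !mxE.
rewrite in_itv/= => -[tab yab] i.
case: (unliftP ord0 i) => [j ->|->]; last by rewrite rV_cons0.
by rewrite rV_consS; have := yab j; rewrite !mxE.
Qed.

(** Ensures that no null set contains a nondegenerate box, as used in [ae_cube_le_continuous]. *)
Lemma lebesgue_rV_box_gt0 d (a b : 'rV[R]_d) :
  (forall i, a ord0 i < b ord0 i) -> (0 < lebesgue_rV d (rV_box a b))%E.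
Proof.
elim: d a b => [|d IH] a b ab.
  rewrite /= diracE mem_set ?lte_fin// => i.
  by case: i => [[]].
rewrite /= /lebesgue_rV_step /pushforward preimage_rV_cons_box.
rewrite product_measure1E//; last exact: measurable_rV_box.
apply: mule_gt0.
- rewrite [ltRHS](lebesgue_measure_itv `[a ord0 ord0, b ord0 ord0]%R) /=.
  by rewrite lte_fin ab -EFinB lte_fin subr_gt0.
- by apply: IH => i; rewrite !mxE.
Qed.

(** Tonelli, after transport along [rV_cons]; this drives the induction on the dimension. *)
Lemma integral_lebesgue_rV_cube d (f : 'rV[R]_d.+1 -> \bar R) :
  measurable_fun setT f -> (forall x, 0 <= f x)%E ->
  (\int[lebesgue_rV d.+1]_(x in cube) f x =
   \int[lebesgue_measure]_(t in `[0%R, 1%R])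
     \int[lebesgue_rV d]_(y in cube) f (rV_cons (t, y)))%E.
Proof.
move=> mf f0; rewrite [LHS]ge0_integral_pushforward//; last 3 first.
- exact: measurable_rV_cons.
- exact: measurable_cube.
- exact: measurable_funTS.
have mc := @measurable_cube d.
rewrite cubeE preimage_rV_cons_box !mxE.
have -> : rV_box (rV_uncons (0 : 'rV[R]_d.+1)).2 (rV_uncons (const_mx 1)).2 =
    cube :> set 'rV[R]_d.
  by rewrite cubeE; congr rV_box; apply/rowP => i; rewrite !mxE.
rewrite integral_mkcond fubini_tonelli1; first last.
- by move=> x; apply: erestrict_ge0 => z _; exact: f0.
- apply/(measurable_restrictT _ _).1; first exact: measurableX.
  apply: measurable_funTS; apply: measurableT_comp => //.
  exact: measurable_rV_cons.
rewrite [RHS]integral_mkcond; apply: eq_integral => t _.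
rewrite /fubini_F patchE; case: ifPn => [|] t01.
  rewrite [RHS]integral_mkcond; apply: eq_integral => y _.
  rewrite !patchE; have -> : ((t, y) \in `[0%R, 1%R] `*` cube) = (y \in cube).
    apply/idP/idP; rewrite !inE; first by case.
    by move=> cy; split=> //; move: t01; rewrite inE.
  by [].
apply: integral0_eq => y _; rewrite patchE ifF//.
by apply/negbTE; move: t01; rewrite !notin_setE => t01 [].
Qed.

End rV_boxes.

(** * Functions that are polynomial in each variable separately *)

Section separately_polynomial.
Variables (R : realType) (n : nat).

Definition set_coor d (x : 'rV[R]_d) i t : 'rV[R]_d :=
  \row_k if k == i then t else x ord0 k.

(** The degree is bounded in each variable, not in total: this passes to slices and involves
    one-variable polynomials only. *)
Definition sep_poly d (f : 'rV[R]_d -> R) := forall i x,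
  exists2 p : {poly R}, (size p <= n.+1)%N &
    forall t, f (set_coor x i t) = p.[t].

Lemma sep_poly_slice d (f : 'rV[R]_d.+1 -> R) t :
  sep_poly f -> sep_poly (fun y => f (rV_cons (t, y))).
Proof.
move=> fp i y; have [p sp pE] := fp (lift ord0 i) (rV_cons (t, y)).
exists p => // s; rewrite -pE; congr f; apply/rowP => k.
case: (unliftP ord0 k) => [j ->|->]; last by rewrite rV_cons0 [RHS]mxE rV_cons0.
by rewrite rV_consS [RHS]mxE rV_consS [LHS]mxE (inj_eq lift_inj).
Qed.

Lemma sep_poly_head d (f : 'rV[R]_d.+1 -> R) y : sep_poly f ->
  exists2 p : {poly R}, (size p <= n.+1)%N &
    forall t, f (rV_cons (t, y)) = p.[t].
Proof.
move=> fp; have [p sp pE] := fp ord0 (rV_cons (0, y)).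
exists p => // t; rewrite -pE; congr f; apply/rowP => k; rewrite [RHS]mxE.
by case: (unliftP ord0 k) => [j ->|->]; rewrite ?rV_cons0 ?rV_consS.
Qed.

Definition lagr (j : 'I_n.+1) : {poly R} :=
  tnth (lagrange n.+1 (fun i : nat => i%:R : R)) j.

Lemma natr_inj : injective (fun i : nat => i%:R : R).
Proof. by move=> i j /eqP; rewrite eqr_nat => /eqP. Qed.

Lemma horner_lagr (p : {poly R}) t : (size p <= n.+1)%N ->
  p.[t] = \sum_(j < n.+1) p.[j%:R] * (lagr j).[t].
Proof.
move=> sp; rewrite {1}(lagrange_gen (ltn0Sn n) natr_inj sp) horner_sum.
by apply: eq_bigr => j _; rewrite hornerM hornerC.
Qed.

(* Interpolation at [0, ..., n] turns polynomiality into linear identities, which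
   are preserved by integration over a parameter. *)
Lemma sep_polyP d (f : 'rV[R]_d -> R) :
  (forall i x t, f (set_coor x i t) =
    \sum_(j < n.+1) f (set_coor x i j%:R) * (lagr j).[t]) <-> sep_poly f.
Proof.
split=> [fE i x|fp i x t]; last first.
  have [p sp pE] := fp i x; rewrite pE (horner_lagr _ sp).
  by apply: eq_bigr => j _; rewrite pE.
exists (\sum_(j < n.+1) f (set_coor x i j%:R) *: lagr j) => [|t]; last first.
  by rewrite fE horner_sum; apply: eq_bigr => j _; rewrite hornerZ.
rewrite (leq_trans (size_sum _ _ _))//; apply/bigmax_leqP => j _.
rewrite (leq_trans (size_scale_leq _ _))//.
by rewrite (size_lagrange_ (ltn0Sn n) natr_inj).
Qed.

(** By induction: interpolation in the first coordinate writes [f] as a finite sum of a slice of [f]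
    times a one-variable polynomial. *)
Lemma measurable_sep_poly d (f : 'rV[R]_d -> R) :
  sep_poly f -> measurable_fun setT f.
Proof.
elim: d f => [|d IH] f fp.
  have -> : f = cst (f 0) by apply/funext => x; rewrite (thinmx0 x).
  exact: measurable_cst.
have -> : f = (fun x => \sum_(j < n.+1)
    f (rV_cons (j%:R, (rV_uncons x).2)) * (lagr j).[x ord0 ord0]).
  apply/funext => x.
  rewrite -{1}(rV_unconsK x) (surjective_pairing (rV_uncons x)).
  have [p sp pE] := sep_poly_head (rV_uncons x).2 fp.
  by rewrite pE (horner_lagr _ sp); apply: eq_bigr => j _; rewrite pE.
apply: measurable_sum => j; apply: measurable_funM.
  apply: (@measurableT_comp _ _ _ _ _ _ (fun y => f (rV_cons (j%:R, y)))
    _ (fun x => (rV_uncons x).2)).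
    by apply: IH; exact: sep_poly_slice.
  by apply: measurableT_comp => //; exact: measurable_rV_uncons.
apply: (@measurableT_comp _ _ _ _ _ _ (horner (lagr j)) _
  (@rV_coor R d.+1 ord0)).
  by apply: continuous_measurable_fun; exact: continuous_horner.
exact: measurable_rV_coor.
Qed.

(** The one-variable bound is applied to the first coordinate, then the induction hypothesis to each
    slice under the integral; every coordinate costs a factor [(n+1)^2]. *)
Lemma le_sqr_integral_sep_poly d (f : 'rV[R]_d -> R) x : sep_poly f -> cube x ->
  ((f x ^+ 2)%:E <= ((n.+1%:R ^+ d) ^+ 2)%:E *
    \int[lebesgue_rV d]_(y in cube) (f y ^+ 2)%:E)%E.
Proof.
elim: d f x => [|d IH] f x fp cx.
  rewrite expr0 expr1n mul1e integral_dirac; first last.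
  - apply/measurable_EFinP; apply: measurable_funX; apply: measurable_funTS.
    exact: measurable_sep_poly.
  - exact: measurable_cube.
  by rewrite diracE mem_set ?mul1e ?(thinmx0 x)// => -[].
have mf2 : measurable_fun setT (fun y => (f y ^+ 2)%:E).
  by apply/measurable_EFinP; apply: measurable_funX; exact: measurable_sep_poly.
have f20 y : (0 <= (f y ^+ 2)%:E)%E by rewrite lee_fin sqr_ge0.
rewrite integral_lebesgue_rV_cube//.
rewrite -(rV_unconsK x) in cx *.
case: (rV_uncons x) cx => t y cx.
have t01 : 0 <= t <= 1 by have := cx ord0; rewrite rV_cons0.
have cy : cube y by move=> i; have := cx (lift ord0 i); rewrite rV_consS.
have [p sp pE] := sep_poly_head y fp.
rewrite pE (le_trans (le_sqr_integral_poly sp t01))//.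
pose F s := (\int[lebesgue_rV d]_(z in cube) (f (rV_cons (s, z)) ^+ 2)%:E)%E.
have F0 s : (0 <= F s)%E by apply: integral_ge0.
have mF : measurable_fun setT F.
  pose g := (fun z : measurableTypeR R * 'rV[R]_d => (f (rV_cons z) ^+ 2)%:E) \_
    (setT `*` cube).
  rewrite (_ : F = fubini_F (lebesgue_rV d) g); last first.
    apply/funext => s; rewrite /F /fubini_F [LHS]integral_mkcond.
    apply: eq_integral => z _; rewrite /g !patchE.
    congr (if _ then _ else _).
    by apply/idP/idP; rewrite !inE; [split|case].
  apply: measurable_fun_fubini_tonelli_F; last exact: erestrict_ge0.
  have mc := @measurable_cube R d.
  apply/(measurable_restrictT _ _).1; first exact: measurableX.
  apply: measurable_funTS.
  exact: (measurableT_comp mf2 (@measurable_rV_cons R d)).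
rewrite [_ ^+ d.+1]exprS exprMn [X in (_ <= X * _)%E]EFinM -muleA.
rewrite lee_pmul2l//.
rewrite -ge0_integralZl//; last 2 first.
- exact: (measurable_funTS mF).
- by move=> s _; exact: F0.
apply: ge0_le_integral => //.
- by move=> s _; rewrite lee_fin sqr_ge0.
- apply/measurable_EFinP/measurable_funTS/measurable_funX.
  by apply: continuous_measurable_fun; exact: continuous_horner.
- by apply: measurable_funTS; exact: measurable_funeM.
- by move=> s _; rewrite -pE; exact: (IH _ _ (sep_poly_slice s fp) cy).
Qed.

End separately_polynomial.

(** * Measures with a density on the cube *)

Section density.
Variables (R : realType) (d : nat) (P : probability 'rV[R]_d R).
Variable p : 'rV[R]_d -> R.
Hypothesis hP : has_density P p.
Hypothesis hinf : (0 < ereal_inf [set (p z)%:E | z in cube])%E.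

Let mcube : measurable (cube : set 'rV[R]_d) := @measurable_cube R d.

Lemma density_lower_bound : exists2 m : R, 0 < m & forall z, cube z -> m <= p z.
Proof.
have le_inf z : cube z -> (ereal_inf [set (p z)%:E | z in cube] <= (p z)%:E)%E.
  by move=> cz; apply: ereal_inf_lbound; exists z.
case: (ereal_inf _) hinf le_inf => [m|_ le_inf|//].
  by rewrite lte_fin => m0 le_inf; exists m => // z /le_inf; rewrite lee_fin.
(* An infinite infimum leaves no point in the cube, so any bound will do. *)
by exists 1 => // z /le_inf; rewrite leye_eq.
Qed.

Lemma density_gt0 z : cube z -> 0 < p z.
Proof. by have [m m0 mp] := density_lower_bound => /mp; exact: lt_le_trans. Qed.

(** The real [sup] in [c_p] is a true upper bound because the inverses of [p] are bounded by
    [m^-1]. *)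
Lemma c_p_density_ge1 z : cube z -> 1 <= c_p p * p z.
Proof.
move=> cz; have [m m0 mp] := density_lower_bound.
rewrite -ler_pdivrMr ?density_gt0// div1r; apply: ub_le_sup; last by exists z.
exists m^-1 => _ [y cy <-]; rewrite lef_pV2 ?posrE ?density_gt0//; exact: mp.
Qed.

Lemma c_p_gt0 : 0 < c_p p.
Proof.
have c0 : (cube : set 'rV[R]_d) 0 by move=> i; rewrite mxE lexx ler01.
rewrite -(pmulr_lgt0 _ (density_gt0 c0)).
exact: lt_le_trans ltr01 (c_p_density_ge1 c0).
Qed.

Lemma probability_cube : P cube = 1%E.
Proof.
by rewrite -(probability_setT P) hP.2// setIid hP.2// setTI.
Qed.

(** Change of variables holds for the Radon-Nikodym derivative of [P]; on the cube [p] equals it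
    almost everywhere, both having the same integral over each measurable subset. *)
Lemma ge0_integral_density (f : 'rV[R]_d -> \bar R) :
  measurable_fun cube f -> (forall x, 0 <= f x)%E ->
  (\int[P]_(x in cube) f x =
   \int[lebesgue_rV d]_(x in cube) (f x * (p x)%:E))%E.
Proof.
move=> mf f0.
have mp : measurable_fun cube (EFin \o p).
  by apply/measurable_EFinP; exact: hP.1.
have dom : P `<< lebesgue_rV d.
  move=> N N0 A mA AN; rewrite hP.2//; apply: null_set_integral.
  - exact: measurableI.
  - by apply: measurable_funS mp => // x [].
  - by apply: N0; [exact: measurableI|move=> x [/AN]].
rewrite -(Radon_Nikodym_SigmaFinite.change_of_variables dom)//.
have mg : measurable_fun cube (Radon_Nikodym_SigmaFinite.f P (lebesgue_rV d)).
  apply: measurable_funTS.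
  exact: measurable_int (Radon_Nikodym_SigmaFinite.f_integrable dom).
apply: ae_eq_integral => //; [exact: emeasurable_funM|exact: emeasurable_funM|].
apply: ae_eqe_mul2l; apply: integral_ae_eq => //.
  apply: integrableS (Radon_Nikodym_SigmaFinite.f_integrable dom) => //.
move=> E Ec mE; rewrite -Radon_Nikodym_SigmaFinite.f_integral//.
by rewrite [LHS](hP.2 E mE) setIidl.
Qed.

Lemma integral_lebesgue_le_density (f : 'rV[R]_d -> \bar R) :
  measurable_fun cube f -> (forall x, 0 <= f x)%E ->
  (\int[lebesgue_rV d]_(x in cube) f x <=
   (c_p p)%:E * \int[P]_(x in cube) f x)%E.
Proof.
move=> mf f0.
have mp : measurable_fun cube (EFin \o p).
  by apply/measurable_EFinP; exact: hP.1.
have p0 x : cube x -> (0 <= (p x)%:E)%E.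
  by move=> /density_gt0/ltW; rewrite lee_fin.
rewrite ge0_integral_density// -ge0_integralZl//; last 3 first.
- exact: emeasurable_funM.
- by move=> x cx; rewrite mule_ge0 ?p0.
- by rewrite lee_fin ltW ?c_p_gt0.
apply: ge0_le_integral => //.
- by apply: measurable_funeM; exact: emeasurable_funM.
- move=> x cx; rewrite muleCA -EFinM lee_pemulr// lee_fin.
  exact: c_p_density_ge1.
Qed.

End density.

(** * Positivity of the eigenvalues *)

Section positivity.
Variable R : realType.

Lemma cvgn_sum (I : Type) (r : seq I) (u : I -> R^nat) (l : I -> R) :
  (forall i, u i @ \oo --> l i) ->
  (fun M => \sum_(i <- r) u i M) @ \oo --> \sum_(i <- r) l i.
Proof.
move=> ul; elim: r => [|i r IH].
  by rewrite big_nil; under eq_fun do rewrite big_nil; exact: cvg_cst.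
by rewrite big_cons; under eq_fun do rewrite big_cons; exact: cvgD.
Qed.

(** Used for the power series of the exponential and for the Mercer expansion: the quadratic form of
    the kernel becomes a weighted series of squares. *)
Lemma cvg_quadratic_form N (K : 'I_N -> 'I_N -> R) (w : R^nat)
    (g : nat -> 'I_N -> R) (c : 'I_N -> R) :
  (forall i j, series (fun m => w m * g m i * g m j) @ \oo --> K i j) ->
  series (fun m => w m * (\sum_i c i * g m i) ^+ 2) @ \oo -->
    \sum_i \sum_j c i * c j * K i j.
Proof.
move=> gK.
have -> : series (fun m => w m * (\sum_i c i * g m i) ^+ 2) = (fun M =>
    \sum_i \sum_j c i * c j * series (fun m => w m * g m i * g m j) M).
  apply/funext => M; rewrite /series /=.
  under [RHS]eq_bigr do under eq_bigr do rewrite mulr_sumr.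
  under [RHS]eq_bigr do rewrite exchange_big.
  rewrite exchange_big; apply: eq_bigr => m _ /=.
  rewrite expr2 mulr_suml mulr_sumr; apply: eq_bigr => i _.
  by rewrite 2!mulr_sumr; apply: eq_bigr => j _; ring.
apply: cvgn_sum => i; apply: cvgn_sum => j.
by apply: cvgMr; exact: gK.
Qed.

(** The diagonal factors [exp (- a t_i^2)] are absorbed into [b]. Expanding [exp (2 a t_i t_j)]
    gives a positively weighted series of squared moments of [b], so all moments vanish; a Lagrange
    polynomial at the nodes then isolates each [b i]. *)
Lemma gauss_positive_definite N (a : R) (t : nat -> R) (c : 'I_N -> R) :
  0 < a -> injective t ->
  \sum_(i < N) \sum_(j < N) c i * c j * expR (- (a * (t i - t j) ^+ 2)) <= 0 ->
  forall i, c i = 0.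
Proof.
move=> a0 tI le0 i0.
pose b (i : 'I_N) := c i * expR (- (a * t i ^+ 2)).
pose w k := (2 * a) ^+ k / k`!%:R.
have w0 k : 0 < w k by rewrite divr_gt0 ?exprn_gt0 ?mulr_gt0// ltr0n fact_gt0.
have cvgE := @cvg_quadratic_form N (fun i j => expR (2 * a * t i * t j)) w
  (fun k i => t i ^+ k) b.
have {}/cvgE cvgE : forall i j : 'I_N,
    series (fun k => w k * t i ^+ k * t j ^+ k) @ \oo -->
    expR (2 * a * t i * t j).
  move=> i j; rewrite (_ : (fun k => _) = exp_coeff (2 * a * t i * t j)).
    exact: is_cvg_series_exp_coeff.
  by apply/funext => k; rewrite /exp_coeff /w /= !exprMn; ring.
have moment0 k : \sum_(i < N) b i * t i ^+ k = 0.
  set m := \sum_(i < N) _; apply/eqP; rewrite -sqrf_eq0 eq_le sqr_ge0 andbT.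
  rewrite -(pmulr_rle0 _ (w0 k)).
  pose u k := w k * (\sum_i b i * t i ^+ k) ^+ 2.
  have u0 n : 0 <= u n by rewrite mulr_ge0 ?sqr_ge0// ltW.
  apply: (@le_trans _ _ (series u k.+1)).
    by rewrite /series /= big_nat_recr//= lerDr sumr_ge0.
  have nd : nondecreasing_seq (series u).
    by apply: nondecreasing_series => n _ _.
  apply: le_trans (nondecreasing_cvgn_le nd _ _) _.
    by apply/cvg_ex; eexists; exact: cvgE.
  rewrite (cvg_lim _ cvgE)//; apply: le_trans le0; rewrite le_eqVlt.
  apply/orP; left; apply/eqP; apply: eq_bigr => i _; apply: eq_bigr => j _.
  have -> : - (a * (t i - t j) ^+ 2) =
      - (a * t i ^+ 2) + - (a * t j ^+ 2) + 2 * a * t i * t j by ring.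
  by rewrite !expRD /b; ring.
have poly0 (p : {poly R}) : \sum_(i < N) b i * p.[t i] = 0.
  under eq_bigr do rewrite horner_coef mulr_sumr.
  rewrite exchange_big big1 //= => k _.
  under eq_bigr do rewrite mulrCA.
  by rewrite -mulr_sumr moment0 mulr0.
case: N => [|N] in c le0 i0 b cvgE moment0 poly0 *; first by case: i0.
have := poly0 (tnth (lagrange N.+1 t) i0).
rewrite (bigD1 i0)//= lagrange_sample// eqxx mulr1 big1 => [|j ji0].
  by rewrite addr0 => /eqP; rewrite mulf_eq0 (gt_eqF (expR_gt0 _)) orbF => /eqP.
by rewrite lagrange_sample// eq_sym (negbTE ji0) mulr0.
Qed.

Lemma gaussian_mercer_gt0 d sigma (P : probability 'rV[R]_d R) p mu phi :
  (0 < d)%N -> 0 < sigma ->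
  mercer_decomposition (gauss_kernel sigma) P p mu phi -> forall l, 0 < mu l.
Proof.
move=> d0 sigma0 hM l; rewrite ltNge; apply/negP => mul0.
pose t (i : nat) : R := i.+1%:R^-1.
have tI : injective t by move=> i j /invr_inj /eqP; rewrite eqr_nat => /eqP[].
(* [c] is a combination of [l + 1] point masses killed by [phi 0, ...,
   phi (l - 1)]; all other terms of the expansion are nonpositive. *)
pose x (i : 'I_l.+1) : 'rV[R]_d := const_mx (t i).
have cx i : cube (x i).
  by move=> k; rewrite mxE invr_ge0 ler0n invf_le1 ?ler1n.
pose A : 'M[R]_(l.+1, l) := \matrix_(i, m) phi m (x i).
have /rowV0Pn[c /sub_kermxP cA0 /eqP c0] : kermx A != 0.
  by rewrite -mxrank_eq0 mxrank_ker subn_eq0 -ltnNge ltnS rank_leq_col.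
apply: c0; apply/rowP => i0; rewrite [RHS]mxE.
apply: (@gauss_positive_definite _ (sigma * d%:R) t (fun i => c ord0 i)) => //.
  by rewrite mulr_gt0// ltr0n.
(* The points lie on the diagonal, where the squared distance is [d (t_i - t_j)^2]; this reduces
   positivity to one dimension. *)
have kE i j : gauss_kernel sigma (x i) (x j) =
    expR (- (sigma * d%:R * (t i - t j) ^+ 2)).
  rewrite /gauss_kernel; under eq_bigr do rewrite !mxE.
  by rewrite sumr_const card_ord -[_ *+ d]mulr_natl; congr expR; ring.
have := @cvg_quadratic_form _ (fun i j => gauss_kernel sigma (x i) (x j)) mu
  (fun m i => phi m (x i)) (fun i => c ord0 i)
  (fun i j => mercer_expansion hM (cx i) (cx j)).
under eq_bigr do under eq_bigr do rewrite kE.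
move=> /[dup] /cvgP hc /cvg_lim <- //; apply: limr_le => //.
near=> M; rewrite /series /= sumr_le0 // => m _.
have [ml|lm] := ltnP m l.
  rewrite (_ : \sum_i _ = 0) ?expr0n ?mulr0//.
  have := congr1 (fun B : 'rV[R]_l => B ord0 (Ordinal ml)) cA0.
  rewrite mxE [RHS]mxE => h; rewrite -[RHS]h.
  by apply: eq_bigr => j _; rewrite mxE.
rewrite mulr_le0_ge0 ?sqr_ge0//.
exact: le_trans (mercer_nonincreasing hM lm) mul0.
Unshelve. all: by end_near. Qed.

End positivity.

(** * Taylor polynomials of the exponential *)

Section exp_taylor.
Variable R : realType.
Implicit Types (u s : R) (N : nat).

Lemma ge0_of_derive_ge0 (f f' : R -> R) u :
  (forall x : R, is_derive x (1 : R) f (f' x)) ->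
  (forall x, 0 <= x -> 0 <= f' x) -> f 0 = 0 -> 0 <= u -> 0 <= f u.
Proof.
move=> ff' f'0 f0 u0; rewrite -f0; apply: (@ger0_derive1_ndecr _ f 0 u) => //.
- move=> x; rewrite in_itv/= => /andP[x0 _].
  by rewrite derive1E derive_val f'0// ltW.
- apply: continuous_subspaceT => x.
  by apply/differentiable_continuous/derivable1_diffP; exact: ex_derive.
Qed.

Definition expN_taylor N : {poly R} := \poly_(j < N) ((-1) ^+ j / j`!%:R).

Lemma deriv_expN_taylor N : (expN_taylor N.+1)^`() = - expN_taylor N.
Proof.
apply/polyP => j; rewrite coef_deriv coefN !coef_poly ltnS.
case: ifP => _; last by rewrite oppr0 mul0rn.
rewrite factS natrM -[LHS]mulr_natr exprS.
by field; rewrite nat1r !pnatr_eq0 -lt0n fact_gt0.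
Qed.

(** The signed remainder of order [N + 1] vanishes at 0 and has the signed remainder of order [N] as
    derivative, so both inequalities integrate from one order to the next. *)
Lemma expN_taylor_bounds N u : 0 <= u ->
  0 <= (-1) ^+ N * (expR (- u) - (expN_taylor N).[u]) <= u ^+ N / N`!%:R.
Proof.
elim: N u => [|N IH] u u0.
  rewrite /expN_taylor poly_def big_ord0 horner0 subr0 !expr0 mul1r.
  by rewrite fact0 divr1 expR_ge0 -expR0 ler_expR oppr_le0.
pose F x := (-1) ^+ N.+1 * (expR (- x) - (expN_taylor N.+1).[x]).
pose F' x := (-1) ^+ N * (expR (- x) - (expN_taylor N).[x]).
have FF' (x : R) : is_derive x (1 : R) F (F' x).
  apply: trigger_derive; rewrite deriv_expN_taylor hornerN exprS /F'.
  by rewrite /GRing.scale/=; ring.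
have F0 : F 0 = 0.
  rewrite /F oppr0 expR0 horner_coef0 coef_poly expr0 fact0 divr1 subrr.
  by rewrite mulr0.
apply/andP; split.
  by apply: (ge0_of_derive_ge0 FF') => // x /IH/andP[].
pose q : {poly R} := (N.+1`!%:R)^-1 *: 'X^(N.+1).
have qE x : q.[x] = x ^+ N.+1 / N.+1`!%:R by rewrite /q !hornerE mulrC.
have q'E x : q^`().[x] = x ^+ N / N`!%:R.
  rewrite derivZ derivXn hornerZ hornerMn hornerXn factS natrM.
  by rewrite -[_ *+ _]mulr_natr /=; field;
  rewrite nat1r !pnatr_eq0 -lt0n fact_gt0.
rewrite -qE -subr_ge0.
apply: (@ge0_of_derive_ge0 (horner q - F) (fun x => q^`().[x] - F' x)) => //.
- by move=> x /IH/andP[_]; rewrite subr_ge0 q'E.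
- by rewrite !fctE F0 qE expr0n mul0r subrr.
Qed.

Lemma expN_taylor_err N u : 0 <= u ->
  `|expR (- u) - (expN_taylor N).[u]| <= u ^+ N / N`!%:R.
Proof.
move=> /(expN_taylor_bounds N) /andP[h0 h1].
by move: h1; rewrite -(ger0_norm h0) normrM normrX normrN1 expr1n mul1r.
Qed.

(** The left side is a single term of the exponential series at [N]. *)
Lemma exprn_fact_le N : N%:R ^+ N / N`!%:R <= expR (N%:R : R).
Proof.
case: N => [|N]; first by rewrite expr0 fact0 divr1 expR0.
by rewrite (le_trans _ (expR_ge1Dxn N _))// lerDr.
Qed.

(** By [exprn_fact_le] the left side is at most [(e a / N)^N]. The ratio is at most [exp (-4/3)],
    and [4 N / 3 >= 2 c s >= 2 s]: hence the factor 3/2. *)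
Lemma exprn_div_fact_le (a c s : R) N : 0 <= a -> 1 <= c -> expR 1 <= s ->
  2 * expR 1 * a <= c -> 3 / 2 * c * s <= N%:R ->
  a ^+ N / N`!%:R <= expR (- (2 * s)).
Proof.
move=> a0 c1 es eac csN.
have e0 : 0 < expR 1 :> R := expR_gt0 1.
have s0 : 0 < s by apply: lt_le_trans es.
have N0 : 0 < N%:R :> R by apply: lt_le_trans csN; nra.
(* [e a / N <= 1 / (3 s) <= 1 / (3 e)], and [exp (1 / 3) <= 3]. *)
have rE : expR 1 * a / N%:R <= expR (- (4 / 3)).
  have e13 : 2 / 3 <= expR (- (1 / 3)) :> R.
    by apply: le_trans (expR_ge1Dx _); lra.
  have -> : - (4 / 3) = - 1 + - (1 / 3) :> R by lra.
  rewrite expRD ler_pdivrMr// expRN.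
  apply: (@le_trans _ _ ((expR 1)^-1 * (2 / 3) * N%:R)); last first.
    by rewrite ler_pM2r// ler_pM2l// invr_gt0.
  rewrite -mulrA [leRHS]mulrC ler_pdivlMr//.
  apply: (@le_trans _ _ (c * s)); last by lra.
  apply: (@le_trans _ _ (c / 2 * expR 1)); first by rewrite ler_pM2r//; lra.
  nra.
have -> : a ^+ N / N`!%:R = (a / N%:R) ^+ N * (N%:R ^+ N / N`!%:R).
  by rewrite mulrA -exprMn divfK// gt_eqF.
apply: (@le_trans _ _ ((a / N%:R) ^+ N * expR (N%:R))).
  by rewrite ler_wpM2l ?exprn_fact_le// exprn_ge0// divr_ge0.
rewrite -[in expR N%:R](mulr1 N%:R) expRM_natl -exprMn.
rewrite (_ : a / N%:R * expR 1 = expR 1 * a / N%:R); last by ring.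
apply: (@le_trans _ _ (expR (- (4 / 3)) ^+ N)).
  by rewrite lerXn2r// nnegrE ?expR_ge0// !mulr_ge0 ?invr_ge0// ltW.
rewrite -expRM_natl ler_expR; nra.
Qed.

End exp_taylor.

(** * Approximation of the eigenfunctions *)

Section weighted_integral.
Context d (T : measurableType d) (R : realType).
Variables (m : {measure set T -> \bar R}) (D : set T) (w : T -> R).
Implicit Types (g : T -> R) (C : R).
Hypotheses (mD : measurable D) (mw : measurable_fun D w).
Hypothesis w1 : (\int[m]_(x in D) `|w x|%:E <= 1)%E.

Lemma weight_integrable : m.-integrable D (EFin \o w).
Proof.
apply/integrableP; split; first exact/measurable_EFinP.
by apply: le_lt_trans w1 _; exact: ltry.
Qed.

Lemma bounded_weight_integrable g C : measurable_fun D g ->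
  (forall x, D x -> `|g x| <= C) ->
  m.-integrable D (EFin \o (fun x => g x * w x)).
Proof.
move=> mg gC; have iw := integrableZl mD `|C| weight_integrable.
apply: le_integrable iw => //.
  by apply/measurable_EFinP; exact: measurable_funM.
move=> x Dx; rewrite /= lee_fin !normrM normr_id ler_wpM2r//.
by rewrite (le_trans (gC _ Dx))// ler_norm.
Qed.

Lemma le_weighted_Rintegral g C : 0 <= C -> measurable_fun D g ->
  (forall x, D x -> `|g x| <= C) -> `|\int[m]_(x in D) (g x * w x)| <= C.
Proof.
move=> C0 mg gC; have ig := bounded_weight_integrable mg gC.
rewrite -lee_fin EFin_normr_Rintegral//.
apply: (le_trans (le_abse_integral m mD _)); first exact: measurable_int ig.
apply: (@le_trans _ _ (\int[m]_(x in D) (C%:E * `|w x|%:E))%E).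
  apply: ge0_le_integral => //.
  - by apply: measurableT_comp => //; exact: measurable_int ig.
  - apply: measurable_funeM; apply/measurable_EFinP.
    exact: measurableT_comp.
  - move=> x Dx; rewrite -EFinM lee_fin normrM ler_wpM2r//; exact: gC.
rewrite ge0_integralZl//; last first.
  by apply/measurable_EFinP; exact: measurableT_comp.
by rewrite -[leRHS]mule1 lee_wpmul2l.
Qed.

(** Carries the interpolation identity of [sep_polyP] through an integral over a parameter. *)
Lemma weighted_Rintegral_sum (I : Type) (r : seq I) (g : I -> T -> R)
    (a C : I -> R) :
  (forall i, measurable_fun D (g i)) -> (forall i x, D x -> `|g i x| <= C i) ->
  \int[m]_(x in D) ((\sum_(i <- r) g i x * a i) * w x) =
  \sum_(i <- r) (\int[m]_(x in D) (g i x * w x)) * a i.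
Proof.
move=> mg gC; have ig i := bounded_weight_integrable (mg i) (@gC i).
have iga i : m.-integrable D (EFin \o (fun x => g i x * w x * a i)).
  rewrite (_ : _ \o _ = fun x => ((a i)%:E * (g i x * w x)%:E)%E).
    exact: (integrableZl mD (a i) (ig i)).
  by apply/funext => x /=; rewrite -EFinM mulrC.
have -> : (fun x => (\sum_(i <- r) g i x * a i) * w x) =
    fun x => \sum_(i <- r) g i x * w x * a i.
  apply/funext => x; rewrite mulr_suml; apply: eq_bigr => i _; ring.
rewrite /Rintegral; under eq_integral do rewrite -sumEFin.
rewrite integral_sum// -sum_fine; last first.
  by move=> i _; exact: (integrable_fin_num mD (iga i)).
by apply: eq_bigr => i _; rewrite -[LHS]/(\int[m]_(x in D) _) RintegralZr.
Qed.

End weighted_integral.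

(** * The Gaussian kernel and its Taylor truncation *)

Section taylor_kernel.
Variables (R : realType) (d : nat) (sigma : R).
Hypothesis sigma0 : 0 <= sigma.
Implicit Types x y z : 'rV[R]_d.

Definition sqdist x y := \sum_(i < d) (x ord0 i - y ord0 i) ^+ 2.

Definition taylor_kernel N x y := (expN_taylor R N).[sigma * sqdist x y].

Lemma sqdist_ge0 x y : 0 <= sqdist x y.
Proof. by apply: sumr_ge0 => i _; exact: sqr_ge0. Qed.

Lemma sqdist_le x y : cube x -> cube y -> sqdist x y <= d%:R.
Proof.
move=> cx cy; rewrite -[X in X%:R]card_ord -sumr_const ler_sum// => i _.
rewrite -real_normK ?num_real// expr_le1// ler_norml.
by have := cx i; have := cy i; lra.
Qed.

Lemma gauss_kernelE x y :
  gauss_kernel sigma x y = expR (- (sigma * sqdist x y)).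
Proof. by rewrite /gauss_kernel mulNr. Qed.

Lemma gauss_kernel_le1 x y : `|gauss_kernel sigma x y| <= 1.
Proof.
rewrite gauss_kernelE ger0_norm ?expR_ge0// -expR0 ler_expR oppr_le0.
by rewrite mulr_ge0// sqdist_ge0.
Qed.

Lemma taylor_kernel_err N x y : cube x -> cube y ->
  `|gauss_kernel sigma x y - taylor_kernel N x y| <=
  (sigma * d%:R) ^+ N / N`!%:R.
Proof.
move=> cx cy; rewrite gauss_kernelE.
have u0 : 0 <= sigma * sqdist x y by rewrite mulr_ge0// sqdist_ge0.
apply: le_trans (expN_taylor_err N u0) _.
rewrite ler_wpM2r ?invr_ge0// lerXn2r ?nnegrE// ?mulr_ge0//.
by rewrite ler_wpM2l// sqdist_le.
Qed.

Lemma measurable_sqdist y : measurable_fun setT (fun x => sqdist x y).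
Proof.
apply: measurable_sum => i; apply: measurable_funX.
apply: measurable_funB => //.
exact: measurable_rV_coor.
Qed.

Lemma measurable_gauss_kernel y :
  measurable_fun setT (fun x => gauss_kernel sigma x y).
Proof.
under eq_fun do rewrite gauss_kernelE -mulNr.
apply: measurableT_comp => //; apply: measurable_funM => //.
exact: measurable_sqdist.
Qed.

Lemma measurable_taylor_kernel N y :
  measurable_fun setT (fun x => taylor_kernel N x y).
Proof.
apply: (@measurableT_comp _ _ _ _ _ _ (horner (expN_taylor R N)) _
  (fun x : 'rV[R]_d => sigma * sqdist x y)).
  by apply: continuous_measurable_fun; exact: continuous_horner.
by apply: measurable_funM => //; exact: measurable_sqdist.
Qed.

(** The point [y] ranges over the whole space because interpolation moves its coordinates to the
    nodes 0, ..., n, outside the cube; hence a bound depending on [y]. *)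
Lemma taylor_kernel_bounded N y :
  exists C, forall x, cube x -> `|taylor_kernel N x y| <= C.
Proof.
pose B : R := \sum_(i < d) (1 + `|y ord0 i|) ^+ 2.
have [C hC] := poly_itv_bound (expN_taylor R N) 0 (sigma * B).
exists C => x cx; apply: hC; rewrite mulr_ge0 ?sqdist_ge0//= ler_wpM2l//.
apply: ler_sum => i _.
rewrite -[leLHS]real_normK ?num_real// lerXn2r ?nnegrE ?addr_ge0//.
rewrite (le_trans (ler_normB _ _))// lerD2r ger0_norm.
  by have /andP[_] := cx i.
by have /andP[] := cx i.
Qed.

(** The squared distance is quadratic in one coordinate, and the truncated exponential has degree at
    most [N]. *)
Lemma sep_poly_taylor_kernel N x : sep_poly N.*2 (taylor_kernel N.+1 x).
Proof.
move=> i y; pose c := \sum_(k < d | k != i) (x ord0 k - y ord0 k) ^+ 2.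
pose b : {poly R} := sigma *: (c%:P + ('X - (x ord0 i)%:P) ^+ 2).
have sb : (size b <= 3)%N.
  rewrite (leq_trans (size_scale_leq _ _))// (leq_trans (size_polyD _ _))//.
  rewrite geq_max (leq_trans (size_polyC_leq1 _))//.
  by rewrite size_exp_XsubC.
exists (expN_taylor R N.+1 \Po b) => [|t].
  rewrite (leq_trans (size_comp_poly_leq _ _))// ltnS.
  rewrite -muln2 leq_mul//.
    by rewrite -subn1 leq_subLR add1n; exact: size_poly.
  by case: (size b) sb.
rewrite horner_comp /taylor_kernel /b /sqdist (bigD1 i)//= !hornerE mxE eqxx.
congr (_.[sigma * _]); rewrite addrC; congr (_ + _); last by ring.
by apply: eq_bigr => k ki; rewrite mxE (negbTE ki).
Qed.

End taylor_kernel.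

(** * From almost everywhere to everywhere on the cube *)

Section everywhere.
Variables (R : realType) (d : nat) (P : probability 'rV[R]_d R).
Variable p : 'rV[R]_d -> R.
Hypothesis hP : has_density P p.
Hypothesis hinf : (0 < ereal_inf [set (p z)%:E | z in cube])%E.

Lemma lebesgue_le_density A : measurable A -> A `<=` cube ->
  (lebesgue_rV d A <= (c_p p)%:E * P A)%E.
Proof.
move=> mA Ac.
have := @integral_lebesgue_le_density _ _ _ _ hP hinf (fun x => (\1_A x)%:E).
have mc := @measurable_cube R d; rewrite !integral_indic//.
rewrite setIidl//; apply => //.
by apply/measurable_EFinP; exact: measurable_indic.
Qed.

(** A violation at [x] would persist on a box in the cube around [x]; that box lies in a [P]-null
    set, hence is Lebesgue null by [lebesgue_le_density], which contradicts its positive volume. *)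
Lemma ae_cube_le_continuous (f : 'rV[R]_d -> R) M :
  {within cube, continuous f} -> {ae P, forall x, cube x -> `|f x| <= M} ->
  forall x, cube x -> `|f x| <= M.
Proof.
move=> /subspace_continuousP cf [B [mB PB0 fB]] x cx.
rewrite leNgt; apply/negP => Mfx.
have : \forall y \near within cube (nbhs x), M < `|f y|.
  exact: (cvgr_gt _ (cvg_norm (cf x cx))).
rewrite /prop_near1 withinE => -[U /nbhs_ballP[e e0 xeU] UM].
(* Clipping to the cube keeps every side of positive length, even at a boundary point. *)
pose a : 'rV[R]_d := \row_i Num.max 0 (x ord0 i - e / 2).
pose b : 'rV[R]_d := \row_i Num.min 1 (x ord0 i + e / 2).
have abE y i : a ord0 i <= y ord0 i <= b ord0 i =
    [&& 0 <= y ord0 i, x ord0 i - e / 2 <= y ord0 i,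
        y ord0 i <= 1 & y ord0 i <= x ord0 i + e / 2].
  by rewrite !mxE ge_max le_min -andbA.
have abB : rV_box a b `<=` B.
  move=> y aby; apply: fB => /= fy.
  have cy : cube y by move=> i; have := aby i; rewrite abE => /and4P[-> _ -> _].
  have : (U `&` cube) y.
    split=> //; apply: xeU; split=> // i j; rewrite (ord1 i).
    have := aby j; rewrite abE => /and4P[_ h1 _ h2].
    rewrite /ball /= ltr_norml; have : 0 < e by []. lra.
  by rewrite -UM => -[]; rewrite ltNge fy.
have : (0 < lebesgue_rV d (rV_box a b))%E.
  apply: lebesgue_rV_box_gt0 => i; rewrite !mxE gt_max !lt_min ltr01 /=.
  by have := cx i; have : 0 < e by []; lra.
have mab := measurable_rV_box a b.
apply/negP; rewrite -leNgt (le_trans (lebesgue_le_density mab _))//.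
  by move=> y aby i; have := aby i; rewrite abE => /and4P[-> _ -> _].
rewrite (_ : P _ = 0%E) ?mule0//; apply/eqP.
by rewrite -measure_le0 -PB0 le_measure ?inE.
Qed.

End everywhere.

(** * Bounds for the eigenfunctions and their polynomial approximations *)

Section eigenfunctions.
Variables (R : realType) (d : nat) (sigma : R).
Variables (P : probability 'rV[R]_d R) (p : 'rV[R]_d -> R).
Variables (mu : nat -> R) (phi : nat -> 'rV[R]_d -> R).
Hypotheses (d0 : (0 < d)%N) (sigma0 : 0 < sigma).
Hypothesis hP : has_density P p.
Hypothesis hinf : (0 < ereal_inf [set (p z)%:E | z in cube])%E.
Hypothesis hM : mercer_decomposition (gauss_kernel sigma) P p mu phi.

Let mcube : measurable (cube : set 'rV[R]_d) := @measurable_cube R d.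

Lemma integral_cube_cst c : (\int[P]_(x in cube) c%:E = c%:E)%E.
Proof.
rewrite integral_cst// -[RHS]mule1; congr (_ * _)%E; exact: probability_cube hP.
Qed.

Lemma measurable_eigenfunction l : measurable_fun cube (phi l).
Proof.
apply/(measurable_restrictT _ mcube).
have /sub_Lfun_mfun := mercer_L2 hM l.
by rewrite inE.
Qed.

(** Orthonormality is stated for the real-valued integral, which is 0 when the integral is infinite;
    the value 1 excludes that case. *)
Lemma integral_eigenfunction_sqr l :
  (\int[P]_(x in cube) (phi l x ^+ 2)%:E = 1)%E.
Proof.
have := mercer_orthonormal hM l l; rewrite eqxx /Rintegral.
under eq_integral do rewrite -expr2.
set I := (\int[P]_(x in cube) _)%E.
have : (0 <= I)%E by apply: integral_ge0 => x _; rewrite lee_fin sqr_ge0.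
by case: I => [r _ /= ->|_ /eqP|//] //; rewrite /= eq_sym oner_eq0.
Qed.

(** Pointwise [|phi| <= (1 + phi^2) / 2], and [P] gives the cube mass 1. *)
Lemma integral_eigenfunction_norm_le1 l :
  (\int[P]_(x in cube) `|phi l x|%:E <= 1)%E.
Proof.
have mphi := measurable_eigenfunction l.
have m2 : measurable_fun cube (fun x => (phi l x ^+ 2)%:E).
  by apply/measurable_EFinP; exact: measurable_funX.
apply: (@le_trans _ _
  (\int[P]_(x in cube) ((2^-1)%:E * (1 + (phi l x ^+ 2)%:E)))%E).
  apply: ge0_le_integral => //.
  - by apply/measurable_EFinP; exact: measurableT_comp.
  - by apply: measurable_funeM; exact: emeasurable_funD.
  - move=> x _; rewrite -EFinD -EFinM lee_fin -[_ ^+ 2]real_normK ?num_real//.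
    by have := sqr_ge0 (`|phi l x| - 1); nra.
rewrite ge0_integralZl//; last 2 first.
- exact: emeasurable_funD.
- by move=> x _; rewrite -EFinD lee_fin addr_ge0// sqr_ge0.
rewrite ge0_integralD//; last by move=> x _; rewrite lee_fin sqr_ge0.
rewrite (integral_cube_cst 1) integral_eigenfunction_sqr.
by rewrite -EFinD -EFinM lee_fin; lra.
Qed.

Section taylor_projection.
Variables (l N : nat).
Hypothesis hN : (sigma * d%:R) ^+ N.+1 / N.+1`!%:R <= mu l / 9.

Let w z := phi l z * p z.

Let mw : measurable_fun cube w.
Proof. by apply: measurable_funM (measurable_eigenfunction l) hP.1. Qed.

Let w1 : (\int[lebesgue_rV d]_(x in cube) `|w x|%:E <= 1)%E.
Proof.
apply: le_trans (integral_eigenfunction_norm_le1 l).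
rewrite (ge0_integral_density hP)//; last first.
  apply/measurable_EFinP; apply: measurableT_comp => //.
  exact: measurable_eigenfunction.
rewrite le_eqVlt; apply/orP; left; apply/eqP; apply: eq_integral => x.
rewrite inE => cx; rewrite -EFinM normrM [`|p x|]ger0_norm// ltW//.
exact: (density_gt0 hinf cx).
Qed.

Definition taylor_projection y :=
  (mu l)^-1 *
    \int[lebesgue_rV d]_(z in cube) (taylor_kernel sigma N.+1 z y * w z).

Let q := taylor_projection.

Let mul_gt0 : 0 < mu l := gaussian_mercer_gt0 d0 sigma0 hM l.

Let mT (y : 'rV[R]_d) :
  measurable_fun cube (fun z => taylor_kernel sigma N.+1 z y).
Proof. by apply: measurable_funTS; exact: measurable_taylor_kernel. Qed.

(** Division of the kernel error [mu l / 9] by [mu l]; the statement inherits its exceptional set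
    from [mercer_eigen]. *)
Lemma taylor_projection_err :
  {ae P, forall y, cube y -> `|phi l y - q y| <= 9^-1}.
Proof.
have := mercer_eigen hM l; apply: filterS => y eigen cy.
have := eigen cy; rewrite /integral_op; under eq_Rintegral do rewrite -mulrA.
rewrite -[LHS]/(\int[_]_(z in _) (gauss_kernel sigma z y * w z)) => eigen_y.
have mk : measurable_fun cube (fun z => gauss_kernel sigma z y).
  by apply: measurable_funTS; exact: measurable_gauss_kernel.
have k1 z : cube z -> `|gauss_kernel sigma z y| <= 1.
  by move=> _; exact: (gauss_kernel_le1 (ltW sigma0) _ _).
have [C TC] := taylor_kernel_bounded (ltW sigma0) N.+1 y.
have -> : phi l y - q y = (mu l)^-1 * \int[lebesgue_rV d]_(z in cube)
    ((gauss_kernel sigma z y - taylor_kernel sigma N.+1 z y) * w z).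
  under [in RHS]eq_Rintegral do rewrite mulrBl.
  rewrite RintegralB//; last 2 first.
  - exact: (bounded_weight_integrable mcube mw w1 mk k1).
  - exact: (bounded_weight_integrable mcube mw w1 (mT y) TC).
  by rewrite eigen_y mulrBr mulKf// gt_eqF.
rewrite normrM gtr0_norm ?invr_gt0// mulrC ler_pdivrMr// mulrC.
apply: (le_weighted_Rintegral mcube mw w1).
- by rewrite divr_ge0// ltW.
- exact: measurable_funB.
- move=> z cz; apply: le_trans hN.
  exact: (taylor_kernel_err (ltW sigma0) _ cz cy).
Qed.

(** The interpolation identity of the truncated kernel is integrated term by term. *)
Lemma sep_poly_taylor_projection : sep_poly N.*2 q.
Proof.
apply/sep_polyP => i y t; rewrite /q /taylor_projection.
have Tsep (z : 'rV[R]_d) := sep_poly_taylor_kernel sigma N z.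
under eq_Rintegral do rewrite ((sep_polyP _ _).2 (Tsep _)).
have /choice[C TC] : forall j : 'I_N.*2.+1, exists C, forall z, cube z ->
    `|taylor_kernel sigma N.+1 z (set_coor y i j%:R)| <= C.
  by move=> j; exact: (taylor_kernel_bounded (ltW sigma0) _ _).
rewrite (weighted_Rintegral_sum mcube mw w1 _ _ (fun j => mT _) TC) mulr_sumr.
by apply: eq_bigr => j _; rewrite mulrA.
Qed.

(** Since [2 (phi^2 + (phi - q)^2) - q^2 = (2 phi - q)^2], the integral is at most
    [2 (1 + 1/81)]. *)
Lemma integral_taylor_projection_sqr :
  (\int[P]_(x in cube) (q x ^+ 2)%:E <= 3%:E)%E.
Proof.
have mphi := measurable_eigenfunction l.
have m2 : measurable_fun cube (fun x => (phi l x ^+ 2)%:E).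
  by apply/measurable_EFinP; exact: measurable_funX.
have mq : measurable_fun cube (fun x => (q x ^+ 2)%:E).
  apply/measurable_EFinP; apply: measurable_funX; apply: measurable_funTS.
  exact: (measurable_sep_poly sep_poly_taylor_projection).
apply: (@le_trans _ _
    (\int[P]_(x in cube) (2%:E * ((phi l x ^+ 2)%:E + (9^-1 ^+ 2)%:E)))%E).
  apply: ae_ge0_le_integral => //.
  - by move=> x _; rewrite lee_fin sqr_ge0.
  - by move=> x _; rewrite -EFinD -EFinM lee_fin mulr_ge0// addr_ge0// sqr_ge0.
  - by apply: measurable_funeM; exact: emeasurable_funD.
  - have := taylor_projection_err; apply: filterS => x err cx.
    have := err cx; rewrite -EFinD -EFinM lee_fin => h.
    have : (phi l x - q x) ^+ 2 <= 9^-1 ^+ 2.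
      by rewrite -[leLHS]real_normK ?num_real// lerXn2r// nnegrE.
    by have := sqr_ge0 (2 * phi l x - q x); lra.
rewrite ge0_integralZl//; first last.
- by move=> x _; rewrite -EFinD lee_fin addr_ge0// sqr_ge0.
- exact: emeasurable_funD.
rewrite ge0_integralD//; last by move=> x _; rewrite lee_fin sqr_ge0.
rewrite integral_cube_cst integral_eigenfunction_sqr -EFinD -EFinM lee_fin; lra.
Qed.

Lemma taylor_projection_bound x : cube x ->
  `|q x| <= Num.sqrt (3 * c_p p) * (N.*2.+1)%:R ^+ d.
Proof.
move=> cx; have mq := measurable_sep_poly sep_poly_taylor_projection.
have cp0 := c_p_gt0 hinf.
have : ((q x ^+ 2)%:E <= ((N.*2.+1%:R ^+ d) ^+ 2)%:E * ((c_p p)%:E * 3%:E))%E.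
  apply: le_trans (le_sqr_integral_sep_poly sep_poly_taylor_projection cx) _.
  rewrite lee_wpmul2l ?lee_fin ?sqr_ge0//.
  apply: le_trans (integral_lebesgue_le_density hP hinf _ _) _.
  - by apply/measurable_EFinP; apply: measurable_funX; apply: measurable_funTS.
  - by move=> y; rewrite lee_fin sqr_ge0.
  - by rewrite lee_wpmul2l ?integral_taylor_projection_sqr// lee_fin ltW.
rewrite -!EFinM lee_fin => h.
rewrite -sqrtr_sqr -[X in _ * X]ger0_norm ?exprn_ge0// -sqrtr_sqr -sqrtrM.
  by rewrite ler_sqrt; [lra|rewrite mulr_ge0 ?sqr_ge0// mulr_ge0// ltW].
by rewrite mulr_ge0// ltW.
Qed.

(** The triangle inequality gives the bound almost everywhere, and continuity of [phi l] extends it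
    to the whole cube. *)
Lemma eigenfunction_bound x : cube x ->
  `|phi l x| <= Num.sqrt (3 * c_p p) * (N.*2.+1)%:R ^+ d + 9^-1.
Proof.
move=> cx.
have cphi : {within cube, continuous (phi l)} by exact: (mercer_continuous hM).
apply: (ae_cube_le_continuous hP hinf cphi _ cx).
have := taylor_projection_err; apply: filterS => y err cy.
rewrite -[phi l y](subrK (q y)) addrC (le_trans (ler_normD _ _))//.
by rewrite lerD ?taylor_projection_bound// err.
Qed.

End taylor_projection.

End eigenfunctions.

Theorem theorem3p5 (R : realType) (d : nat) (hd : (1 <= d)%N)
  (sigma : R) (hsigma : 0 < sigma)
  (P : probability 'rV[R]_d R) (p : 'rV[R]_d -> R)
  (hP : has_density P p)
  (hinf : (0 < ereal_inf [set (p z)%:E | z in cube])%E)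
  (hsup : (ereal_sup [set (p z)%:E | z in cube] < +oo)%E)
  (mu : nat -> R) (phi : nat -> 'rV[R]_d -> R)
  (hmercer : mercer_decomposition (gauss_kernel sigma) P p mu phi) :
  forall l : nat,
    (ereal_sup [set `|phi l x|%:E | x in cube] <=
      (Num.sqrt (18 * c_p p)
         * (3 * c_sigma d sigma * s_trunc sigma p (mu l) + 2) ^+ d
       + Num.sqrt 2)%:E)%E.
Proof.
move=> l; apply: ge_ereal_sup => _ [x cx <-]; rewrite lee_fin.
have mul_gt0 := gaussian_mercer_gt0 hd hsigma hmercer l.
have cp_gt0 := c_p_gt0 hinf.
set s := s_trunc _ _ _; set c := c_sigma _ _.
have c1 : 1 <= c by rewrite /c /c_sigma le_max lexx.
have c_ge : 2 * expR 1 * (sigma * d%:R) <= c.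
  by rewrite /c /c_sigma le_max !mulrA lexx orbT.
have es : expR 1 <= s by rewrite /s /s_trunc !le_max lexx orbT.
have s_ge : - 2^-1 * ln (mu l / 9) <= s by rewrite /s /s_trunc le_max lexx.
have s0 : 0 < s := lt_le_trans (expR_gt0 1) es.
have X0 : 0 <= 3 / 2 * c * s by rewrite !mulr_ge0 ?ltW// (lt_le_trans ltr01).
(* With [N] the integer part of [3 c s / 2], [N + 1] is large enough for the Taylor error while
   [2 N + 1 <= 3 c s + 1]. *)
have /andP[NX XN] := truncn_itv X0.
move: (Num.truncn _) NX XN => N NX XN.
have hN : (sigma * d%:R) ^+ N.+1 / N.+1`!%:R <= mu l / 9.
  apply: (@le_trans _ _ (expR (- (2 * s)))).
    apply: (@exprn_div_fact_le _ _ c) => //; last exact: ltW.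
    by rewrite mulr_ge0// ltW.
  (* The first term of the maximum defining [s] gives [- 2 s <= ln (mu l / 9)]. *)
  rewrite -[leRHS]lnK ?posrE ?divr_gt0// ler_expR; lra.
apply: le_trans (eigenfunction_bound hd hsigma hP hinf hmercer hN cx) _.
have N_le : N.*2.+1%:R <= 3 * c * s + 2 :> R.
  by rewrite -[N.*2.+1]addn1 -muln2 natrD natrM; lra.
(* The constants leave room: [1/9 <= sqrt 2] and [3 <= 18]. *)
apply: lerD; last first.
  rewrite -[leLHS]ger0_norm// -sqrtr_sqr ler_sqrt//; lra.
apply: ler_pM; rewrite ?sqrtr_ge0 ?exprn_ge0//.
  by rewrite ler_sqrt ?ler_pM2r ?mulr_ge0 ?ler_nat// ltW.
by apply: lerXn2r; rewrite ?nnegrE// (le_trans _ N_le).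
Qed.
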